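(* Let $l$ and $m$ be positive integers and let $p=n^{\alpha}$, where (a) if $l$ is even, $\alpha\in\left[-2,\frac{-4}{l+2}\right]$; (b) if $l$ is odd, $\alpha\in\left[-2,\frac{-4(l+2)}{(l+1)(l+3)}\right]$. Then asymptotically almost surely $\tilde H_l(N_m(G(n,p)))=0$.
   Context: $G(n,p)$ is the Erdős–Rényi random graph on $n$ vertices in which each edge appears independently with probability $p$. For a graph $G$ and a nonnegative integer $m$, the multineighbor complex $N_m(G)$ is the simplicial complex in which a set of $q+1$ vertices of $G$ ($q\ge 0$) is a $q$-simplex if and only if these vertices have at least $m$ common neighbors in $G$. $\tilde H_*$ denotes reduced simplicial homology with integer coefficients. A property holds asymptotically almost surely (a.a.s.) if its probability tends to $1$ as $n\to\infty$. Here $l$, $m$ and $\alpha$ are fixed as $n\to\infty$. *)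

(* Defs.v *)
From HB Require Import structures.
From mathcomp Require Import all_boot all_order all_algebra.
From mathcomp Require Import all_classical all_reals all_analysis.
Set Implicit Arguments.
Unset Strict Implicit.
Unset Printing Implicit Defensive.
Import Order.TTheory GRing.Theory Num.Theory.
Import numFieldNormedType.Exports.
Local Open Scope ring_scope.

Record scomplex (n : nat) := SComplex {
  faces : {set {set 'I_n}};
  faces_neq0 : forall s, s \in faces -> s != finset.set0;
  faces_sub : forall s t : {set 'I_n},
    s \in faces -> t != finset.set0 -> t \subset s -> t \in faces }.

(* Simplices are graded by their number k of vertices (dimension k - 1).  The
   empty set is the unique simplex with k = 0, of every complex: this is the
   augmentation used by reduced homology. *)
Definition is_simplex n (K : scomplex n) (k : nat) (s : {set 'I_n}) : bool :=
  (#|s| == k) && ((s == finset.set0) || (s \in faces K)).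

Definition simplex n (K : scomplex n) k := {s : {set 'I_n} | is_simplex K k s}.

(* Integral chains: every simplex is oriented by the order of 'I_n. *)
Definition chain n (K : scomplex n) k := {ffun simplex K k -> int}.

(* The position of v among the vertices of s. *)
Definition vpos n (s : {set 'I_n}) (v : 'I_n) : nat :=
  #|[set u in s | (u < v)%N]|.

(* The coefficient of t in the boundary of s = [v_0 < ... < v_k], i.e. in
   \sum_i (-1)^i [v_0, ..., v_(i-1), v_(i+1), ..., v_k]. *)
Definition incidence n (s t : {set 'I_n}) : int :=
  \sum_(v in s | s :\ v == t) (-1) ^+ vpos s v.

Definition bdry n (K : scomplex n) k (c : chain K k.+1) : chain K k :=
  [ffun t => \sum_(s : simplex K k.+1) c s * incidence (val s) (val t)].

Lemma bdryB n (K : scomplex n) k (c d : chain K k.+1) :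
  bdry (c - d) = bdry c - bdry d.
Proof.
apply/ffunP => t; rewrite !ffunE -sumrB; apply: eq_bigr => s _.
by rewrite !ffunE mulrBl.
Qed.

Lemma bdry0 n (K : scomplex n) k : bdry (0 : chain K k.+1) = 0.
Proof. by rewrite -[X in bdry X](subrr 0) bdryB subrr. Qed.

Lemma vposD1 n (s : {set 'I_n}) (v w : 'I_n) :
  v \in s -> vpos s w = ((v < w)%N + vpos (s :\ v) w)%N.
Proof.
move=> vs; rewrite /vpos (cardsD1 v) inE vs; congr (_ + _)%N.
by apply: eq_card => x; rewrite !inE andbA.
Qed.

Lemma sign_swap n (s : {set 'I_n}) (v w : 'I_n) : v \in s -> w \in s -> v != w ->
  (-1) ^+ vpos s v * (-1) ^+ vpos (s :\ v) w
    = - ((-1) ^+ vpos s w * (-1) ^+ vpos (s :\ w) v) :> int.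
Proof.
move=> vs ws vw; rewrite (vposD1 v ws) (vposD1 w vs).
have [vltw|wltv|/val_inj vew] := ltngtP v w; last by rewrite vew eqxx in vw.
  by rewrite add0n add1n exprS mulN1r mulNr opprK mulrC.
by rewrite add0n add1n exprS mulN1r mulNr mulrC.
Qed.

Lemma bdry_bdry n (K : scomplex n) k (c : chain K k.+2) : bdry (bdry c) = 0.
Proof.
apply/ffunP => t; rewrite !ffunE.
under eq_bigr => u _ do rewrite ffunE mulr_suml.
rewrite exchange_big big1 //= => s _.
under eq_bigr => u _ do rewrite -mulrA.
rewrite -mulr_sumr; set S := \sum_(u : _) _; suff -> : S = 0 by rewrite mulr0.
have face v : v \in val s -> is_simplex K k.+1 (val s :\ v).
  move=> vs; case/andP: (valP s) => /eqP cs /orP[/eqP s0|sK].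
    by rewrite s0 inE in vs.
  have c1 : #|val s :\ v| = k.+1 by move: cs; rewrite (cardsD1 v) vs => -[].
  rewrite /is_simplex c1 eqxx /=; apply/orP; right.
  by apply: (faces_sub sK); rewrite ?subD1set // -card_gt0 c1.
have -> : S = \sum_(v in val s) \sum_(w in val s | (v != w) && (val s :\ v :\ w == val t))
    (-1) ^+ vpos (val s) v * (-1) ^+ vpos (val s :\ v) w.
  rewrite {}/S; under eq_bigr => u _ do rewrite /incidence mulr_suml.
  rewrite (exchange_big_dep (fun v => v \in val s)) /=; last by move=> ? ? _ /andP[].
  apply: eq_bigr => v vs; rewrite (big_pred1 (Sub _ (face v vs))) => [|u].
    rewrite /= /incidence mulr_sumr; apply: eq_bigl => w.
    by rewrite !inE [w == v]eq_sym -andbA andbCA.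
  by rewrite vs /= eq_sym -val_eqE.
set T := \sum_(v in _) _; suff TN : T = - T.
  by apply/eqP; rewrite -[_ == 0](mulrn_eq0 T 2) mulr2n {1}TN addNr.
rewrite {1}/T (exchange_big_dep (fun v => v \in val s)) /=; last by move=> ? ? _ /andP[].
rewrite /T -sumrN; apply: eq_bigr => v vs; rewrite -sumrN.
apply: eq_big => [w|w /and4P[ws _ wv _]].
  by rewrite vs [w == v]eq_sym !finset.setDDl [[set w] :|: _]finset.setUC.
exact: sign_swap.
Qed.

Section Homology.
Variables (n : nat) (K : scomplex n) (q : nat).

Definition is_cycle : {pred chain K q.+1} := fun z => bdry z == 0.

Fact is_cycle_zmod_closed : zmod_closed is_cycle.
Proof.
split=> [|x y]; rewrite /in_mem /= /is_cycle ?bdry0 //.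
by rewrite bdryB => /eqP-> /eqP->; rewrite subrr.
Qed.
HB.instance Definition _ :=
  GRing.isZmodClosed.Build (chain K q.+1) is_cycle is_cycle_zmod_closed.

Record cycles := Cycle { cycle_val : chain K q.+1; _ : is_cycle cycle_val }.
HB.instance Definition _ := [isSub for cycle_val].
HB.instance Definition _ := [Choice of cycles by <:].
HB.instance Definition _ := [SubChoice_isSubZmodule of cycles by <:].

Definition is_boundary : {pred cycles} :=
  fun z => `[< exists c : chain K q.+2, bdry c = cycle_val z >].

Fact is_boundary_zmod_closed : zmod_closed is_boundary.
Proof.
split=> [|x y]; first by apply/asboolP; exists 0; rewrite bdry0 -[RHS]/(val 0) raddf0.
move=> /asboolP[c cx] /asboolP[d dy]; apply/asboolP; exists (c - d).
by rewrite bdryB cx dy -[RHS]/(val (x - y)) raddfB.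
Qed.
HB.instance Definition _ :=
  GRing.isZmodClosed.Build cycles is_boundary is_boundary_zmod_closed.

(* The reduced homology group in degree q >= 0. *)
Definition reduced_homology : zmodType := Quotient.quot is_boundary.

End Homology.

Definition trivial_group (A : zmodType) : Prop := forall x : A, x = 0.

Lemma trivial_homologyP n (K : scomplex n) q :
  trivial_group (reduced_homology K q) <->
  forall z : chain K q.+1, bdry z = 0 -> exists c : chain K q.+2, bdry c = z.
Proof.
pose Q : quotType (cycles K q) := Quotient.quot (@is_boundary n K q).
have pi0 (z : cycles K q) : \pi_Q%qT z = 0 :> Quotient.quot (@is_boundary n K q)
    <-> is_boundary z.
  have := @Quotient.idealrBE _ (@is_boundary n K q) z 0; rewrite subr0 => E.
  have z0 : \pi_Q%qT 0 = 0 :> Quotient.quot (@is_boundary n K q) by rewrite piE.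
  rewrite -z0; split=> [/eqP|zB]; first by rewrite -E.
  by apply/eqP; rewrite -E.
split=> [H z /eqP z0|H x].
  by have /asboolP := (pi0 (Cycle z0)).1 (H _).
rewrite -[x](@reprK _ Q); apply: (pi0 _).2; apply/asboolP/H.
by case: (repr _) => z /= /eqP.
Qed.

(* A simple graph on 'I_n is its set of edges, an edge being an unordered pair
   of distinct vertices. *)
Definition vpair (n : nat) := {e : {set 'I_n} | #|e| == 2}.
Definition graph (n : nat) := {set vpair n}.

Definition adj n (G : graph n) (u v : 'I_n) : bool :=
  [exists e in G, val e == [set u; v]%SET].

Definition common_nbrs n (G : graph n) (s : {set 'I_n}) : {set 'I_n} :=
  [set w | [forall v in s, adj G v w]]%SET.

Definition nbr_faces (m n : nat) (G : graph n) : {set {set 'I_n}} :=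
  [set s : {set 'I_n} | (s != finset.set0) && (m <= #|common_nbrs G s|)%N]%SET.

Fact nbr_faces_neq0 m n (G : graph n) s :
  s \in nbr_faces m G -> s != finset.set0.
Proof. by rewrite inE => /andP[]. Qed.

Fact nbr_faces_sub m n (G : graph n) (s t : {set 'I_n}) :
  s \in nbr_faces m G -> t != finset.set0 -> t \subset s -> t \in nbr_faces m G.
Proof.
rewrite !inE => /andP[_ ms] -> /fintype.subsetP ts; apply: leq_trans ms _.
apply/subset_leq_card/fintype.subsetP => w; rewrite !inE => /forall_inP sw.
by apply/forall_inP => v /ts /sw.
Qed.

Definition multineighbor_complex (m n : nat) (G : graph n) : scomplex n :=
  SComplex (@nbr_faces_neq0 m n G) (@nbr_faces_sub m n G).

(* The law of G(n,p). *)
Definition gnp_weight (R : realType) (n : nat) (p : R) (G : graph n) : R :=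
  \prod_(e : vpair n) (if e \in G then p else 1 - p).

Lemma gnp_weight_sum (R : realType) (n : nat) (p : R) :
  \sum_(G : graph n) gnp_weight p G = 1.
Proof.
transitivity (\prod_(e : vpair n) (p + (1 - p))); last first.
  by rewrite big1 // => e _; rewrite addrC subrK.
by rewrite bigA_distr; apply: eq_bigl => G; rewrite inE.
Qed.

Definition gnp_prob (R : realType) (n : nat) (p : R) (P : graph n -> Prop) : R :=
  \sum_(G : graph n | `[< P G >]) gnp_weight p G.

(* P holds a.a.s. for G(n, p n). *)
Definition aas (R : realType) (p : nat -> R) (P : forall n, graph n -> Prop) :=
  ((fun n => gnp_prob (p n) (@P n)) @ \oo --> (1 : R))%classic.

(* Main.v *)
(* The members A of the complex that are closed, A = CN (CN A) with CN the
   common neighbours, form an intersection-closed family of sets whose subsets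
   are the simplices.  Removing a maximal member and applying Mayer-Vietoris,
   one sees that such a family has no homology in degree l unless it contains
   a chain A_0 < ... < A_l, and even then not if the member of the chain in
   some fixed position is determined by the others.  A chain of closed sets
   yields complete bipartite subgraphs K_(i+1,l+1-i) of G.  Two of them that
   share a vertex and are distinct span a subgraph too dense to occur a.a.s.:
   for odd l these are the two middle ones in a single chain; for even l they
   come from two chains that differ in the middle member only.  The second
   case is what allows alpha = -4/(l+2), where single copies of
   K_(l/2+1,l/2+1) do occur with positive limiting probability. *)
Require Import Defs.
From mathcomp Require Import all_boot all_order all_algebra.
From mathcomp Require Import all_classical all_reals all_analysis.
(* Imported again so that the names of finset hide those of classical_sets. *)
From mathcomp Require Import fintype finset.
From mathcomp Require Import ring lra zify.
Set Implicit Arguments.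
Unset Strict Implicit.
Unset Printing Implicit Defensive.
Import Order.TTheory GRing.Theory Num.Theory.
Import numFieldNormedType.Exports.
Local Open Scope ring_scope.

(** * Chains on families of sets *)

Section SetChains.
Variable n : nat.
Implicit Types (s t A B : {set 'I_n}) (P : {set {set 'I_n}}).
Implicit Types (z c : {set 'I_n} -> int) (v w : 'I_n).

(** Chains are functions on all subsets of ['I_n], so that one function can be regarded in several
    complexes at once. *)
Definition bd z t : int :=
  \sum_(v | v \notin t) (-1) ^+ vpos (v |: t) v * z (v |: t).

(** The members of [P] generate the complex. The empty set is covered even by the empty family,
    which provides the augmentation of reduced homology. *)
Definition covered P s := (s == set0) || [exists A in P, s \subset A].

Definition carried P k z := forall s, z s != 0 -> #|s| = k /\ covered P s.

(** Since [k] counts vertices, this is vanishing of reduced homology in degree [k - 1]. *)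
Definition acyclic P k := forall z, carried P k z -> (forall t, bd z t = 0) ->
  exists2 c, carried P k.+1 c & bd c =1 z.

Lemma eq_bd z c : z =1 c -> bd z =1 bd c.
Proof. by move=> e t; apply: eq_bigr => v _; rewrite e. Qed.

Lemma bdD z c t : bd (fun s => z s + c s) t = bd z t + bd c t.
Proof. by rewrite -big_split; apply: eq_bigr => v _; rewrite mulrDr. Qed.

Lemma bdB z c t : bd (fun s => z s - c s) t = bd z t - bd c t.
Proof. by rewrite -sumrB; apply: eq_bigr => v _; rewrite mulrBr. Qed.

Lemma bd_bd z t : bd (bd z) t = 0.
Proof.
pose F v w : int := (-1) ^+ vpos (v |: t) v *
  ((-1) ^+ vpos (w |: (v |: t)) w * z (w |: (v |: t))).
pose T := \sum_(v | v \notin t) \sum_(w | (w \notin t) && (w != v)) F v w.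
have -> : bd (bd z) t = T.
  apply: eq_bigr => v vt; rewrite mulr_sumr; apply: eq_bigl => w.
  by rewrite !inE negb_or andbC.
(* Exchanging the order in which [v] and [w] are removed changes the sign. *)
have TN : T = - T.
  rewrite {1}/T (exchange_big_dep (fun w => w \notin t)) /=; last first.
    by move=> ? ? _ /andP[].
  rewrite /T -sumrN; apply: eq_bigr => w wt; rewrite -sumrN.
  apply: eq_big => [v|v /and3P[vt _ wv]].
    by rewrite wt /= eq_sym.
  have e : v |: (w |: t) = w |: (v |: t) by rewrite !setUA (setUC [set v]).
  have vw : v != w by rewrite eq_sym.
  have := @sign_swap n (w |: (v |: t)) v w; rewrite !inE !eqxx orbT vw.
  rewrite -{2}e !setU1K ?inE ?negb_or ?wt ?vt ?wv ?vw //.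
  move=> /(_ isT isT isT) E; rewrite /F e !mulrA -mulNr; congr (_ * _).
  by rewrite mulrC [in RHS]mulrC E opprK.
by apply/eqP; rewrite -[_ == 0](mulrn_eq0 T 2) mulr2n {1}TN addNr.
Qed.

Lemma coveredS P s t : t \subset s -> covered P s -> covered P t.
Proof.
move=> ts /orP[/eqP s0|/exists_inP[A AP sA]].
  by move: ts; rewrite s0 subset0 /covered => ->.
by apply/orP; right; apply/exists_inP; exists A; rewrite // (subset_trans ts).
Qed.

Lemma covered_in P A s : A \in P -> s \subset A -> covered P s.
Proof. by move=> AP sA; apply/orP; right; apply/exists_inP; exists A. Qed.

Lemma covered1 A s : covered [set A] s = (s \subset A).
Proof.
apply/idP/idP => [/orP[/eqP->|/exists_inP[B /set1P->//]]|]; first exact: sub0set.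
exact/covered_in/set11.
Qed.

Lemma covered_fam P Q s : (forall A, A \in P -> covered Q A) ->
  covered P s -> covered Q s.
Proof.
move=> PQ /orP[s0|/exists_inP[A /PQ QA sA]]; first by rewrite /covered s0.
exact: coveredS sA QA.
Qed.

Lemma carried_fam P Q k z : (forall A, A \in P -> covered Q A) ->
  carried P k z -> carried Q k z.
Proof. by move=> PQ zP s /zP[-> /(covered_fam PQ)]. Qed.

Lemma carriedD P k z c : carried P k z -> carried P k c ->
  carried P k (fun s => z s + c s).
Proof.
move=> zP cP s; have [z0|/zP//] := eqVneq (z s) 0.
by rewrite z0 add0r => /cP.
Qed.

Lemma carriedB P k z c : carried P k z -> carried P k c ->
  carried P k (fun s => z s - c s).
Proof.
move=> zP cP; apply: carriedD => // s; rewrite oppr_eq0; exact: cP.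
Qed.

Lemma carried_bd P k z : carried P k.+1 z -> carried P k (bd z).
Proof.
move=> zP t bt; have [v vt zv] : exists2 v, v \notin t & z (v |: t) != 0.
  apply/exists_inP; apply: contraR bt => /exists_inPn H.
  by apply/eqP/big1 => v /H /negPn/eqP->; rewrite mulr0.
have [+ cv] := zP _ zv; rewrite cardsU1 vt add1n => -[->]; split=> //.
exact: coveredS (subsetUr _ _) cv.
Qed.

(* The cone over a vertex v of A is a contraction of the simplex A. *)
Lemma simplex_acyclic A k : A != set0 -> acyclic [set A] k.
Proof.
case/set0Pn => v vA z zA bz.
exists (fun s => if v \in s then (-1) ^+ vpos s v * z (s :\ v) else 0).
  move=> s; case: ifP => [vs|]; last by rewrite eqxx.
  rewrite mulf_eq0 signr_eq0 /= => /zA[cs]; rewrite !covered1 => sA.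
  rewrite (cardsD1 v) vs cs; split=> //.
  by rewrite -(setD1K vs) subUset sub1set vA.
move=> t; rewrite /bd.
case vt: (v \in t); last first.
  rewrite (bigD1 v) ?vt //= setU11 setU1K ?vt // mulrA -signr_odd -expr2.
  rewrite sqrr_sign mul1r big1 ?addr0 // => w /andP[wt wv].
  by rewrite !inE vt eq_sym (negPf wv) mulr0.
(* The cycle condition at [t :\ v] expresses [z t] by the other cofaces of [t :\ v], which match the
   terms of the cone one by one. *)
have := bz (t :\ v); rewrite /bd (bigD1 v) ?inE ?eqxx //= setD1K //.
move/eqP; rewrite addr_eq0 => /eqP E.
have {E} -> : z t = - ((-1) ^+ vpos t v * \sum_(w | (w \notin t :\ v) && (w != v))
   (-1) ^+ vpos (w |: t :\ v) w * z (w |: t :\ v)).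
  by rewrite -mulrN -E mulrA -signr_odd -expr2 sqrr_sign mul1r.
rewrite mulr_sumr -sumrN; apply: eq_big => [w|w wt].
  by rewrite !inE andbC; case: eqVneq => [->|]; rewrite ?vt.
have wv : w != v by apply: contraNneq wt => ->.
rewrite inE vt orbT.
have e : (w |: t) :\ v = w |: t :\ v.
  by apply/setP => x; rewrite !inE; case: eqVneq => [->|//]; rewrite eq_sym (negPf wv).
have := @sign_swap n (w |: t) v w; rewrite !inE vt eqxx orbT eq_sym wv => /(_ isT isT isT).
rewrite e setU1K // => E; rewrite !mulrA -mulNr; congr (_ * _).
set b := (-1) ^+ vpos (w |: t :\ v) w in E *.
have /(congr1 ( *%R b)) : b * (-1) ^+ vpos (w |: t) v =
    - ((-1) ^+ vpos (w |: t) w * (-1) ^+ vpos t v) by rewrite mulrC.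
rewrite signrMK => ->; rewrite mulrN mulrCA mulrN signrMK.
by rewrite mulrC.
Qed.

Definition cap_closed P :=
  {in P &, forall A B, A :&: B != set0 -> A :&: B \in P}.

Definition below P A := [set B in P | B \proper A].

(* Mayer-Vietoris for the simplex on a maximal member A and the complex of the
   other members, whose intersection is the complex of [below P A]. *)
Lemma acyclic_step P k : set0 \notin P -> cap_closed P ->
  (forall A, A \in P -> acyclic (below P A) k) -> acyclic P k.+1.
Proof.
have [N] := ubnP #|P|; elim: N P => // N IH P PN P0 capP accP z zP bz.
have [PE|[B BP]] := set_0Vmem P.
  exists (fun=> 0) => [s|t]; first by rewrite eqxx.
  rewrite /bd big1 => [|v _]; last by rewrite mulr0.
  apply/eqP; rewrite eq_sym; apply: contraT => /zP[ct /orP[/eqP t0|]].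
    by rewrite t0 cards0 in ct.
  by case/exists_inP => A; rewrite PE inE.
have [A /maxsetP[AP maxA] _] := @maxset_exists _ (fun C => C \in P) B BP.
pose P' := P :\ A.
have maxP' C : C \in P' -> A \subset C -> False.
  by rewrite !inE => /andP[CA CP] /(maxA _ CP) e; rewrite e eqxx in CA.
have P'P : P' \subset P by apply: subD1set.
have capP' : cap_closed P'.
  move=> C D CP' DP' CD0; rewrite !inE capP ?(subsetP P'P) // andbT.
  by apply/eqP => e; apply: (maxP' C) => //; rewrite -e subsetIl.
have below' C : C \in P' -> below P' C = below P C.
  move=> CP'; apply/setP => D; rewrite !inE.
  case: eqVneq => [->|//]; rewrite AP andTb andFb; apply/esym/negP => /proper_sub.
  exact: maxP'.
have accP' : acyclic P' k.+1.
  apply: IH => //; first by rewrite (cardsD1 A) AP in PN.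
    by apply: contra P0 => /(subsetP P'P).
  by move=> C CP'; rewrite below' //; apply/accP/(subsetP P'P).
have LP' : below P A \subset P'.
  apply/subsetP => C; rewrite !inE => /andP[-> CA]; rewrite andbT.
  by apply: contraTneq CA => ->; rewrite properxx.
(* [w] is the part of [z] that only the simplex on [A] can carry. *)
pose w s := if (s \subset A) && ~~ covered P' s then z s else 0.
have wA : carried [set A] k.+1 w.
  move=> s; rewrite /w covered1; case: ifP => [/andP[-> _] /zP[]//|].
  by rewrite eqxx.
have zwP' : carried P' k.+1 (fun s => z s - w s).
  move=> s; rewrite /w; case: (boolP (covered P' s)) => [cs|ncs].
    by rewrite andbF subr0 => /zP[].
  rewrite andbT; case: ifP => [|sA]; first by rewrite subrr eqxx.
  rewrite subr0 => /zP[-> /orP[s0|/exists_inP[C CP sC]]]; split=> //.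
    by rewrite /covered s0 in ncs.
  case/negP: ncs; apply: (covered_in _ sC); rewrite !inE CP andbT.
  by apply: contraFneq sA => <-.
have bzw t : bd (fun s => z s - w s) t = - bd w t by rewrite bdB bz sub0r.
(* As [bd w = - bd (z - w)], each simplex of [bd w] lies in [A] and in some other member [C]; by
   maximality of [A], [C :&: A] is proper in [A]. *)
have bwL : carried (below P A) k (bd w).
  move=> t wt; have [ct] := carried_bd wA wt; rewrite covered1 => tA.
  have [|_ ] := carried_bd zwP' (s := t); first by rewrite bzw oppr_eq0.
  case/orP => [t0|/exists_inP[C CP' tC]]; split=> //; first by rewrite /covered t0.
  have [t0|t0] := eqVneq t set0; first by rewrite /covered t0 eqxx.
  have tCA : t \subset C :&: A by rewrite subsetI tC.
  apply: (covered_in _ tCA); rewrite inE (capP _ _ (subsetP P'P _ CP') AP) //=; last first.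
    by apply: contraNneq t0 => e; rewrite -subset0 -e.
  rewrite properE subsetIr /= subsetI subxx andbT; apply/negP; exact: maxP'.
(* Filling [bd w] by [u] in the intersection splits [z] into the cycles [w - u] on [A] and
   [z - w + u] on [P'], which are filled separately. *)
have [u uL bu] := accP A AP _ bwL (bd_bd w).
have A0 : A != set0 by apply: contraNneq P0 => <-.
have [|t|x xA bx] := simplex_acyclic A0 (k := k.+1) (z := fun s => w s - u s).
- apply: carriedB => //; apply: carried_fam uL => C; rewrite inE => /andP[_ CA].
  by rewrite covered1 proper_sub.
- by rewrite bdB bu subrr.
have [|t|y yP' by_] := accP' (fun s => (z s - w s) + u s).
- apply: carriedD => //; apply: carried_fam uL => C /(subsetP LP') CP'.
  exact: covered_in CP' _.
- by rewrite bdD bzw bu addNr.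
exists (fun s => x s + y s) => [|t].
  apply: carriedD; first apply: carried_fam xA => C /set1P->.
    exact: covered_in AP _.
  by apply: carried_fam yP' => C /(subsetP P'P) CP; apply: covered_in CP _.
by rewrite bdD bx by_ addrACA addNr addr0 addrC subrK.
Qed.

Definition chain_in P := fun c : seq {set 'I_n} =>
  all [in P] c && sorted (fun A B => B \proper A) c.

Lemma below_sub P A : below P A \subset P.
Proof. by apply/subsetP => B; rewrite inE => /andP[]. Qed.

Lemma below0 P A : set0 \notin P -> set0 \notin below P A.
Proof. by apply: contra; apply/subsetP/below_sub. Qed.

Lemma cap_closed_below P A : cap_closed P -> cap_closed (below P A).
Proof.
move=> capP B C; rewrite !inE => /andP[BP BA] /andP[CP CA] BC.
by rewrite capP //= (sub_proper_trans (subsetIl B C)).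
Qed.

Lemma chain_in_below P A (c : seq {set 'I_n}) :
  A \in P -> chain_in (below P A) c -> chain_in P (A :: c).
Proof.
move=> AP; rewrite /chain_in /= AP; case: c => //= B c /andP[/andP[+ cP] ->].
rewrite inE => /andP[-> ->]; rewrite /= andbT.
by apply: sub_all cP => C; rewrite inE => /andP[].
Qed.

(** Each use of [acyclic_step] fixes the largest member of a chain and passes to the members below
    it. For [k = 0] the empty chain contradicts the hypothesis. *)
Lemma acyclic_no_chain P k : set0 \notin P -> cap_closed P ->
  (forall c : seq {set 'I_n}, size c = k -> ~~ chain_in P c) -> acyclic P k.
Proof.
elim: k P => [|k IH] P P0 capP noc; first by have := noc [::] erefl.
apply: acyclic_step => // A AP; apply: IH (below0 _ P0) (cap_closed_below capP) _.
by move=> c ck; apply: contra (noc (A :: c) _) => [|/=]; [apply: chain_in_below|rewrite ck].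
Qed.

(* If A :: B :: q is a chain, then A is the only member of P larger than B, so
   B may be deleted from P without changing the complex; deleting all such B
   leaves no chain of length j.+2. *)
Lemma acyclic_unique_top P j : set0 \notin P -> cap_closed P ->
  (forall q A B, size q = j.+1 ->
     chain_in P (A :: q) -> chain_in P (B :: q) -> A = B) ->
  acyclic P j.+2.
Proof.
move=> P0 capP uniqP.
pose top A B := exists2 q, size q = j & chain_in P (A :: B :: q).
have topU A B C : top A B -> C \in P -> B \proper C -> C = A.
  case=> q qj chA CP BC; apply: (uniqP (B :: q)) => //=; first by rewrite qj.
  by move: chA; rewrite /chain_in /= CP BC => /andP[/andP[_ ->] /andP[_ ->]].
have topI A B : top A B -> A \in P /\ B \proper A.
  by case=> q _ /andP[/andP[-> _] /andP[-> _]].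
pose Q := [set B in P | ~~ `[< exists A, top A B >]].
have QP : Q \subset P by apply/subsetP => B; rewrite inE => /andP[].
(* If [B :&: C] were deleted, the only member above it would equal both [B] and [C], hence also
   their intersection. *)
have capQ : cap_closed Q.
  move=> B C BQ CQ BC0; have [BP CP] := (subsetP QP _ BQ, subsetP QP _ CQ).
  rewrite inE capP //=; apply/asboolPn => -[A tA].
  have above D : D \in Q -> B :&: C \subset D -> D = A.
    rewrite inE => /andP[DP /asboolPn ntD]; rewrite subEproper => /orP[/eqP e|].
      by case: ntD; exists A; rewrite -e.
    exact: topU tA DP.
  have := (topI _ _ tA).2.
  have [-> ->] := (above B BQ (subsetIl B C), above C CQ (subsetIr B C)).
  by rewrite setIid properxx.
(* A deleted [A] lies in a member [B] that is kept: a [C] above [B] would be a second member above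
   [A]. *)
have PQ A : A \in P -> covered Q A.
  move=> AP; have [[B tB]|ntA] := pselect (exists B, top B A); last first.
    by apply: (covered_in (A := A)); rewrite // inE AP; apply/asboolPn.
  have [BP AB] := topI _ _ tB; apply: (covered_in (A := B)); last exact: proper_sub.
  rewrite inE BP; apply/asboolPn => -[C tC]; have [CP BC] := topI _ _ tC.
  have CB := topU _ _ _ tB CP (proper_trans AB BC).
  by rewrite CB properxx in BC.
have accQ : acyclic Q j.+2.
  apply: acyclic_no_chain => //; first by apply: contra P0 => /(subsetP QP).
  move=> [|A [|B c]] // [cj]; apply/negP => /andP[cQ sc].
  have /and3P[_ + _] := cQ; rewrite inE => /andP[_ /asboolPn[]].
  exists A; exists c => //; rewrite /chain_in sc andbT.
  by apply: sub_all cQ => C /(subsetP QP).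
move=> z zP bz; have [||c cQ bc] := accQ z => //; first exact: carried_fam zP.
by exists c => //; apply: carried_fam cQ => A /(subsetP QP) AP; apply: covered_in AP _.
Qed.

(** Stripping the [i] members of [p] by [acyclic_step] makes the varying member the largest one,
    where [acyclic_unique_top] applies. *)
Lemma acyclic_no_fork P i j : set0 \notin P -> cap_closed P ->
  (forall p q A B, size p = i -> size q = j.+1 ->
     chain_in P (p ++ A :: q) -> chain_in P (p ++ B :: q) -> A = B) ->
  acyclic P (i + j.+2).
Proof.
elim: i P => [|i IH] P P0 capP nofork.
  by apply: acyclic_unique_top => // q A B; apply: (nofork [::]).
rewrite addSn; apply: acyclic_step => // C CP.
apply: IH (below0 _ P0) (cap_closed_below capP) _ => p q A B pi qj chA chB.
by apply: (nofork (C :: p) q); rewrite /= ?pi //; apply: chain_in_below.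
Qed.

End SetChains.

(** * Homology of the multineighbor complex *)

Section Transport.
Variables (n : nat) (K : scomplex n) (P : {set {set 'I_n}}).
Hypothesis facesE : forall s, s \in faces K = (s != set0) && covered P s.

Definition extend k (c : chain K k) (s : {set 'I_n}) : int :=
  if insub s is Some u then c u else 0.

Lemma is_simplexE k s : is_simplex K k s = (#|s| == k) && covered P s.
Proof.
by rewrite /is_simplex facesE /covered; case: (s == set0).
Qed.

Lemma extend_val k (c : chain K k) (u : simplex K k) : extend c (val u) = c u.
Proof. by rewrite /extend valK. Qed.

Lemma extend_carried k (c : chain K k) : carried P k (extend c).
Proof.
move=> s; rewrite /extend; case: insubP => [u + _ _|]; last by rewrite eqxx.
by rewrite is_simplexE => /andP[/eqP].
Qed.

Lemma bd_extend k (c : chain K k.+1) (t : simplex K k) :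
  bd (extend c) (val t) = bdry c t.
Proof.
rewrite /bdry ffunE; under [RHS]eq_bigr do rewrite mulr_sumr.
rewrite (exchange_big_dep (fun v => v \notin val t)) /=; last first.
  by move=> s v _ /andP[_ /eqP e]; rewrite -[val t]e !inE eqxx.
apply: eq_bigr => v vt.
rewrite (eq_bigl (fun s : simplex K k.+1 => val s == v |: val t)); last first.
  move=> s; apply/andP/eqP => [[vs /eqP e]|->]; first by rewrite -[val t]e setD1K.
  by rewrite setU11 setU1K.
rewrite /extend; case: insubP => [u _ uE|nS].
  rewrite (big_pred1 u) => [|s]; first by rewrite uE mulrC.
  by rewrite -uE (inj_eq val_inj).
rewrite big_pred0 ?mulr0 // => s; apply/negP => /eqP e.
by case/negP: nS; rewrite -e (valP s).
Qed.

Lemma trivial_homology_acyclic q :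
  acyclic P q.+1 -> trivial_group (reduced_homology K q).
Proof.
move=> acP; apply/trivial_homologyP => z bz.
have [|c cP bc] := acP _ (@extend_carried _ z).
  move=> t; apply: contraTeq isT => bt.
  have [ct cvt] := carried_bd (@extend_carried _ z) bt.
  have St : is_simplex K q t by rewrite is_simplexE ct eqxx.
  by move: bt; rewrite -[t]/(val (Sub t St : simplex K q)) bd_extend bz ffunE eqxx.
exists [ffun s : simplex K q.+2 => c (val s)].
apply/ffunP => t; rewrite -bd_extend -[RHS]extend_val -bc; apply: eq_bd => s.
rewrite /extend; case: insubP => [u _ <-|]; first by rewrite ffunE.
by rewrite is_simplexE; have [->|/cP[-> ->]] := eqVneq (c s) 0; rewrite ?eqxx.
Qed.

End Transport.

(** * Closed sets of common neighbours, and the bicliques they span *)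

Section ClosedSets.
Variables (n m : nat) (G : graph n).
Implicit Types (A B S : {set 'I_n}) (u v : 'I_n).
Local Notation CN := (common_nbrs G).

Lemma adj_sym u v : adj G u v = adj G v u.
Proof. by rewrite /adj setUC. Qed.

Lemma adj_neq u v : adj G u v -> u != v.
Proof.
case/exists_inP => e _ /eqP eE; apply/eqP => uv; move: (valP e).
by rewrite eE uv setUid cards1.
Qed.

Lemma in_CN A v : (v \in CN A) = [forall u in A, adj G u v].
Proof. by rewrite inE. Qed.

Lemma sub_CN_sym A B : (A \subset CN B) = (B \subset CN A).
Proof.
suff sub (C D : {set 'I_n}) : C \subset CN D -> D \subset CN C by apply/idP/idP; apply: sub.
move=> /subsetP CD; apply/subsetP => v vD; rewrite in_CN; apply/forall_inP => u.
by move=> /CD; rewrite in_CN adj_sym => /forall_inP; apply.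
Qed.

Lemma sub_CNCN A : A \subset CN (CN A).
Proof. by rewrite sub_CN_sym. Qed.

Lemma CN_anti A B : A \subset B -> CN B \subset CN A.
Proof. by move=> AB; rewrite sub_CN_sym (subset_trans AB) // sub_CNCN. Qed.

Lemma CNK A : CN (CN (CN A)) = CN A.
Proof. by apply/eqP; rewrite eqEsubset CN_anti sub_CNCN. Qed.

(** Adjacency induces a Galois connection with closure operator [CN (CN A)]; these are its closed
    simplices. *)
Definition closed_sets : {set {set 'I_n}} :=
  [set A | [&& A != set0, CN (CN A) == A & (m <= #|CN A|)%N]].

Lemma closed_sets0 : set0 \notin closed_sets.
Proof. by rewrite inE eqxx. Qed.

Lemma cap_closed_sets : cap_closed closed_sets.
Proof.
move=> A B; rewrite !inE => /and3P[_ /eqP Ac mA] /and3P[_ /eqP Bc _] ->.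
rewrite (leq_trans mA) ?subset_leq_card ?CN_anti ?subsetIl // andbT /=.
rewrite eqEsubset sub_CNCN subsetI andbT.
have := CN_anti (CN_anti (subsetIl A B)).
by have := CN_anti (CN_anti (subsetIr A B)); rewrite Ac Bc => -> ->.
Qed.

(** The closure of a simplex is again a simplex, because it has the same common neighbours. *)
Lemma faces_closed_sets s :
  (s \in faces (multineighbor_complex m G)) = (s != set0) && covered closed_sets s.
Proof.
rewrite /= /nbr_faces inE; case: (eqVneq s set0) => //= s0.
apply/idP/orP => [ms|[|/exists_inP[A]]]; last 2 first.
- by rewrite (negPf s0).
- rewrite inE => /and3P[_ _ mA] sA; apply: leq_trans mA _.
  exact/subset_leq_card/CN_anti.
right; apply/exists_inP; exists (CN (CN s)); last exact: sub_CNCN.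
rewrite inE !CNK eqxx ms /= andbT; apply: contraNneq s0 => e.
by rewrite -subset0 -e sub_CNCN.
Qed.

Lemma multineighbor_homology_acyclic l : acyclic closed_sets l.+1 ->
  trivial_group (reduced_homology (multineighbor_complex m G) l).
Proof. exact/trivial_homology_acyclic/faces_closed_sets. Qed.

Lemma closed_proper A B : A \in closed_sets -> A \proper B -> CN B \proper CN A.
Proof.
rewrite inE => /and3P[_ /eqP Ac _]; rewrite !properE => /andP[AB BA].
rewrite CN_anti //=; apply: contra BA => /CN_anti.
by rewrite Ac; apply: subset_trans; apply: sub_CNCN.
Qed.

Lemma chain_in_catr (P : {set {set 'I_n}}) p q : chain_in P (p ++ q) -> chain_in P q.
Proof. by rewrite /chain_in all_cat => /andP[/andP[_ ->] /cat_sorted2[_ ->]]. Qed.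

(** Each step of the chain costs a vertex: the members shrink strictly down to a nonempty set, while
    their common neighbours grow strictly, starting from at least [m] at the head. This bounds from
    below both sides of the biclique on [A] and [CN A]. *)
Lemma chain_cards p A q : chain_in closed_sets (p ++ A :: q) ->
  (size q < #|A|)%N /\ (m + size p <= #|CN A|)%N.
Proof.
rewrite /chain_in all_cat => /andP[/andP[pP /andP[AP qP]] chA]; split.
  have {chA} /cat_sorted2[_ /= chA] := chA.
  elim: q A AP qP chA => [|B q IH] A AP /=.
    by move: AP; rewrite inE card_gt0 => /andP[].
  case/andP=> BP qP /andP[BA chB]; exact: leq_ltn_trans (IH B BP qP chB) (proper_card BA).
have mP B : B \in closed_sets -> (m <= #|CN B|)%N by rewrite inE => /and3P[].
case: p pP chA => [|C p] /=; first by rewrite addn0 mP.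
rewrite cat_path /= => /andP[CP pP] /and3P[chC lA _].
rewrite addnS; apply: leq_ltn_trans (proper_card (closed_proper AP lA)).
apply: leq_trans (_ : #|CN C| + size p <= _)%N; first by rewrite leq_add2r mP.
elim: p C {CP lA} pP chC => [|D p IH] C /=; first by rewrite addn0.
case/andP=> DP pP /andP[DC chD]; apply: leq_trans (IH D pP chD).
by rewrite addnS -addSn leq_add2r proper_card // closed_proper.
Qed.

Definition deg S u := #|[set v in S | adj G u v]|.

Definition edges_in S : {set vpair n} := [set e in G | val e \subset S].

Lemma sum_deg S : (\sum_(u in S) deg S u <= 2 * #|edges_in S|)%N.
Proof.
have -> : (2 * #|edges_in S| = \sum_(e in edges_in S) \sum_(u in S | u \in val e) 1)%N.
  rewrite mulnC -sum_nat_const; apply: eq_bigr => e.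
  rewrite inE => /andP[_ /subsetP eS]; rewrite sum1_card.
  transitivity #|val e|; first by apply/esym/eqP/(valP e).
  apply: eq_card => u; apply/idP/andP => [ue|[]//].
  by split=> //; apply: eS.
rewrite (exchange_big_dep (fun u => u \in S)) /=; last by move=> ? ? _ /andP[].
apply: leq_sum => u uS; rewrite sum1_card.
(* Edges at [u] are mapped onto the neighbours of [u] by taking the other endpoint. The default [u]
   never occurs for an edge, which has two vertices. *)
pose other (e : vpair n) := odflt u [pick v in val e :\ u].
pose E : {set vpair n} := [set e in edges_in S | u \in val e].
apply: (@leq_trans #|other @: E|); last first.
  apply: leq_trans (leq_imset_card _ _) _; apply/subset_leq_card/subsetP => e.
  by rewrite inE => /andP[eS ue]; apply/and3P; split.
apply/subset_leq_card/subsetP => v; rewrite inE => /andP[vS auv].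
have uv := adj_neq auv; case/exists_inP: auv => e eG /eqP eE.
apply/imsetP; exists e.
  by rewrite !inE eG eE subUset !sub1set uS vS set21.
have eu : val e :\ u = [set v].
  by apply/setP => x; rewrite eE !inE; case: (eqVneq x u) => [->|]; rewrite ?(negPf uv).
rewrite /other eu; case: pickP => [x|/(_ v)]; rewrite inE; first by move/eqP.
by rewrite eqxx.
Qed.

Lemma min_degree_regular a S : (\sum_(u in S) deg S u <= a * #|S|)%N ->
  (forall u, u \in S -> a <= deg S u)%N -> forall u, u \in S -> deg S u = a.
Proof.
move=> ub lb; have /leqif_sum : forall u, u \in S -> (a <= deg S u ?= iff (a == deg S u))%N.
  by move=> u /lb au; split.
rewrite sum_nat_const mulnC => -[_]; rewrite eqn_leq ub andbT.
have -> : (a * #|S| <= \sum_(u in S) deg S u)%N.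
  by rewrite mulnC -sum_nat_const leq_sum.
by move/esym/forall_inP => H u /H /eqP.
Qed.

Lemma deg_geq S u B : B \subset S -> {in B, forall v, adj G u v} ->
  (#|B| <= deg S u)%N.
Proof.
move=> BS aB; apply/subset_leq_card/subsetP => v vB.
by rewrite inE (subsetP BS) ?aB.
Qed.

Lemma CN_adj A B u v : A \subset CN B -> u \in A -> v \in B -> adj G u v.
Proof.
by move=> /subsetP AB /AB; rewrite in_CN adj_sym => /forall_inP; apply.
Qed.

Lemma exists_subset_card A k : (k <= #|A|)%N ->
  exists2 B : {set 'I_n}, B \subset A & #|B| = k.
Proof.
move=> kA; exists [set x in take k (enum A)].
  by apply/subsetP => x; rewrite inE => /mem_take; rewrite mem_enum.
rewrite cardsE (card_uniqP (take_uniq _ (enum_uniq _))) size_takel //.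
by rewrite -cardE.
Qed.

(** * Even degree [l = 2 * (a - 1)] *)

Section Even.
Variable a : nat.
(** The average degree is at most that of K_(a,a); the size bound leaves room for the union of two
    copies. *)
Hypothesis sparse : forall S, (#|S| <= 4 * a)%N ->
  (\sum_(u in S) deg S u <= a * #|S|)%N.

(** Otherwise there is a K_(a,a+1), with all degrees at least [a] and some larger, against the bound
    [a] on the average. *)
Lemma sparse_biclique A B : (0 < a)%N -> (a <= #|A|)%N -> (a <= #|B|)%N ->
  A \subset CN B -> #|B| = a.
Proof.
move=> a0 aA aB AB; apply/eqP; rewrite eqn_leq aB andbT leqNgt; apply/negP => Ba.
have [X XA Xa] := exists_subset_card aA; have [Y YB Ya] := exists_subset_card Ba.
have adjXY u v : u \in X -> v \in Y -> adj G u v.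
  by move=> /(subsetP XA) uA /(subsetP YB); apply: CN_adj AB uA.
pose S := X :|: Y.
have degX u : u \in X -> (a.+1 <= deg S u)%N.
  by move=> uX; rewrite -Ya deg_geq ?subsetUr // => v; apply: adjXY.
have degY v : v \in Y -> (a <= deg S v)%N.
  by move=> vY; rewrite -Xa deg_geq ?subsetUl // => u uX; rewrite adj_sym adjXY.
have [u uX] : exists u, u \in X by apply/set0Pn; rewrite -card_gt0 Xa.
have := degX u uX; rewrite (@min_degree_regular a S) ?ltnn //.
- by apply: sparse; have [+ _] := leq_card_setU X Y; rewrite -/S; lia.
- by move=> w /setUP[/degX/ltnW|/degY].
- by rewrite inE uX.
Qed.

(* The union of the copies of K_(a,a) on A, CN A and on B, CN B is a-regular, so
   a vertex common to A and B, here from q, has no room for CN A <> CN B. *)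
Lemma sparse_no_fork p q A B : (0 < m)%N -> size p = a.-1 -> size q = a.-1 ->
  (1 < a)%N -> chain_in closed_sets (p ++ A :: q) ->
  chain_in closed_sets (p ++ B :: q) -> A = B.
Proof.
move=> m0 pa qa a1 chA chB.
have a0 : (0 < a)%N by lia.
have [[aA aCA] [aB aCB]] := (chain_cards chA, chain_cards chB).
rewrite pa qa in aA aCA aB aCB.
have {}aA : (a <= #|A|)%N by lia.
have {}aB : (a <= #|B|)%N by lia.
have {}aCA : (a <= #|CN A|)%N by lia.
have {}aCB : (a <= #|CN B|)%N by lia.
(* As [a > 1], [q] has a head, and any vertex of it lies in both [A] and [B]. *)
have [u [uA uB]] : exists u, u \in A /\ u \in B.
  case: q qa chA chB => [|C q] /= qa; first by lia.
  have sub D : chain_in closed_sets (p ++ D :: C :: q) -> C \in closed_sets /\ C \subset D.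
    by move=> /chain_in_catr /andP[/and3P[_ -> _] /andP[/proper_sub-> _]].
  move=> /sub[+ CA] /sub[_ CB]; rewrite inE => /andP[/set0Pn[u uC] _].
  by exists u; rewrite (subsetP CA) ?(subsetP CB).
have cA : #|CN A| = a by apply: sparse_biclique (sub_CNCN A).
have cB : #|CN B| = a by apply: sparse_biclique (sub_CNCN B).
have c2A : #|A| = a by apply: (sparse_biclique a0 aCA aA).
have c2B : #|B| = a by apply: (sparse_biclique a0 aCB aB).
pose S := (A :|: B) :|: (CN A :|: CN B).
have S4 : (#|S| <= 4 * a)%N.
  have [+ _] := leq_card_setU (A :|: B) (CN A :|: CN B); rewrite -/S.
  have [+ _] := leq_card_setU A B; have [+ _] := leq_card_setU (CN A) (CN B).
  by rewrite cA cB c2A c2B; lia.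
have adjCN (D : {set 'I_n}) w v : w \in D -> v \in CN D -> adj G w v.
  exact: CN_adj (sub_CNCN D).
have degS w : w \in S -> (a <= deg S w)%N.
  have degD (D E : {set 'I_n}) : D \subset CN E -> E \subset S -> (a <= #|E|)%N -> w \in D ->
      (a <= deg S w)%N.
    move=> DE ES aE wD; apply: leq_trans aE _.
    by apply: deg_geq ES _ => v; apply: CN_adj DE wD.
  have SA : A \subset S by rewrite /S -setUA subsetUl.
  have SB : B \subset S by rewrite /S [A :|: B]setUC -setUA subsetUl.
  have SCA : CN A \subset S by rewrite /S setUCA subsetUl.
  have SCB : CN B \subset S by rewrite /S [CN A :|: _]setUC setUCA subsetUl.
  case/setUP=> /setUP[]; [apply: degD (sub_CNCN A) _ _|apply: degD (sub_CNCN B) _ _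
    |apply: degD (subxx (CN A)) _ _|apply: degD (subxx (CN B)) _ _] => //.
have regS := min_degree_regular (sparse S4) degS.
have : (#|CN A :|: CN B| <= a)%N.
  rewrite -(regS u); last by rewrite !inE uA.
  by apply: deg_geq; [apply: subsetUr|move=> v /setUP[]; apply: adjCN].
move=> cU.
have eU C : #|CN C| = a -> CN C \subset CN A :|: CN B -> CN C = CN A :|: CN B.
  by move=> cC sC; apply/eqP; rewrite eqEcard sC cC.
have e : CN A = CN B by rewrite (eU A cA) ?subsetUl // -(eU B cB) ?subsetUr.
have closedE D : chain_in closed_sets (p ++ D :: q) -> CN (CN D) = D.
  move=> /chain_in_catr /andP[/andP[+ _] _]; rewrite inE.
  by case/and3P => _ /eqP.
by rewrite -(closedE _ chA) e (closedE _ chB).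
Qed.

End Even.

(** After division by [a] the last two inequalities give [4 * a + 2 <= s]. *)
Lemma odd_density_absurd a s d : (0 < a)%N -> (s <= 2 * a + 2)%N ->
  (a * s + 2 * a <= d)%N -> ((2 * a).+1 * d <= 2 * a * a.+1 * s)%N -> False.
Proof.
move=> a0 s2 sd ds.
have : (a * ((2 * a).+1 * (s + 2)) <= a * (2 * a.+1 * s))%N.
  apply: leq_trans (_ : (2 * a).+1 * d <= _)%N; last by move: ds; lia.
  by have := leq_mul (leqnn (2 * a).+1) sd; lia.
by rewrite leq_pmul2l //; lia.
Qed.

(** * Odd degree [l = 2 * a - 1] *)

Section Odd.
Variable a : nat.
(** The bound on the average degree is the average degree of K_(a,a+1). *)
Hypothesis sparse : forall S, (#|S| <= 4 * a)%N ->
  ((2 * a).+1 * \sum_(u in S) deg S u <= 2 * a * a.+1 * #|S|)%N.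

(** The two middle members, [A] proper in [B], give a K_(a,a) on [X] in [A] and [Y] in [CN B]. A
    vertex [x] of [B] outside [A] is joined to all of [Y], and a vertex [y] of [CN A] outside [CN B]
    to all of [X]; together this is too dense. *)
Lemma sparse_no_chain c : (0 < m)%N -> (0 < a)%N -> size c = (2 * a)%N ->
  ~~ chain_in closed_sets c.
Proof.
move=> m0 a0 sc; apply/negP => ch.
have [p [B [A [q [cE pa qa]]]]] : exists p B A q,
    [/\ c = p ++ [:: B, A & q], size p = a.-1 & size q = a.-1].
  move: (cat_take_drop a.-1 c) (size_drop a.-1 c) (size_takel (n0 := a.-1) (s := c)).
  rewrite sc; case: (drop _ _) => [|B [|A q]] /= e sd st; try lia.
  by exists (take a.-1 c), B, A, q; split; rewrite ?e ?st //; lia.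
move: ch; rewrite cE => ch.
have [] := chain_cards ch; rewrite /= pa qa => _ aCB.
move: (ch); rewrite -cat_rcons => /chain_cards []; rewrite size_rcons pa qa => aA aCA.
have /andP[/and3P[BP AP _] /andP[AB _]] := chain_in_catr ch.
have [x xB xA] : exists2 x, x \in B & x \notin A by case/properP: AB => _ [x]; exists x.
have [y yA yB] : exists2 y, y \in CN A & y \notin CN B.
  by case/properP: (closed_proper AP AB) => _ [y]; exists y.
have [X XA Xa] : exists2 X : {set 'I_n}, X \subset A & #|X| = a.
  by apply: exists_subset_card; rewrite -(prednK a0).
have [Y YB Ya] : exists2 Y : {set 'I_n}, Y \subset CN B & #|Y| = a.
  by apply: exists_subset_card; apply: leq_trans aCB; rewrite -{1}(prednK a0) -add1n leq_add2r.
have adjCN (D : {set 'I_n}) w v : w \in D -> v \in CN D -> adj G w v.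
  exact: CN_adj (sub_CNCN D).
have YA : Y \subset CN A by apply: subset_trans YB (CN_anti (proper_sub AB)).
have adjXY u v : u \in X -> v \in Y -> adj G u v.
  by move=> /(subsetP XA) uA /(subsetP YA); apply: adjCN.
pose XY := X :|: Y; pose S := [set x; y] :|: XY.
have XYa : #|XY| = (2 * a)%N.
  rewrite cardsU Xa Ya (_ : X :&: Y = set0) ?cards0; first by rewrite subn0 addnn mul2n.
  apply/setP => w; rewrite !inE; apply/negP => /andP[wX wY].
  by have /adj_neq := adjXY _ _ wX wY; rewrite eqxx.
(* Only an upper bound holds, since [x] and [y] may coincide. *)
have S2 : (#|S| <= 2 * a + 2)%N.
  have [+ _] := leq_card_setU [set x; y] XY; rewrite -/S XYa cards2 addnC.
  by move=> /leq_trans; apply; rewrite leq_add2l; case: (x != y).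
have XS : X \subset S by rewrite /S /XY setUCA subsetUl.
have YS : Y \subset S by rewrite /S /XY setUA subsetUr.
have degS w : w \in S -> (a + (w \in XY) <= deg S w)%N.
  have degX : w \in X -> (a.+1 <= deg S w)%N.
    move=> wX; have <- : #|y |: Y| = a.+1.
      by rewrite cardsU1 Ya; case: (boolP (y \in Y)) => // /(subsetP YB); rewrite (negPf yB).
    apply: deg_geq => [|v]; first by rewrite subUset sub1set YS !inE eqxx orbT.
    case/setU1P => [->|]; last exact: adjXY.
    exact: adjCN (subsetP XA _ wX) yA.
  have degY : w \in Y -> (a.+1 <= deg S w)%N.
    move=> wY; have <- : #|x |: X| = a.+1.
      by rewrite cardsU1 Xa; case: (boolP (x \in X)) => // /(subsetP XA); rewrite (negPf xA).
    apply: deg_geq => [|v]; first by rewrite subUset sub1set XS !inE eqxx.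
    rewrite adj_sym; case/setU1P => [->|vX]; last exact: adjXY.
    exact: adjCN xB (subsetP YB _ wY).
  case: (boolP (w \in XY)) => [/setUP[/degX|/degY]|wXY]; rewrite ?addn1 ?addn0 //.
  rewrite /S in_setU (negPf wXY) orbF => /set2P[] ->.
    by rewrite -Ya; apply: deg_geq => // v /(subsetP YB); apply: adjCN.
  rewrite -Xa; apply: deg_geq => // v /(subsetP XA) vA.
  by rewrite adj_sym; apply: adjCN yA.
have sumS : (a * #|S| + 2 * a <= \sum_(u in S) deg S u)%N.
  have : (\sum_(u in S) (a + (u \in XY)) <= \sum_(u in S) deg S u)%N by apply: leq_sum.
  apply: leq_trans; rewrite big_split /= sum_nat_const mulnC.
  rewrite leq_add2l -XYa -sum1_card [leqLHS]big_mkcond [leqRHS]big_mkcond.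
  apply: leq_sum => u _; case: (boolP (u \in XY)) => // uXY.
  by rewrite (subsetP (subsetUr _ _) _ uXY).
have := sparse (S := S); have S4 : (#|S| <= 4 * a)%N.
  by apply: leq_trans S2 _; clear -a0; lia.
move=> /(_ S4) dS; exact: odd_density_absurd a0 S2 sumS dS.
Qed.

End Odd.

End ClosedSets.

(** * Sparsity of G(n,p) *)

Section Sparse.
Variable R : realType.
Implicit Types (p alpha : R) (n M : nat).

(** For [p = n^alpha], the quantity required to be nonnegative is the exponent of [n] in the
    expected number of copies of a fixed graph with these numbers of vertices and edges. *)
Definition sparse_graph alpha M n (G : graph n) :=
  forall S : {set 'I_n}, (#|S| <= M)%N ->
    0 <= #|S|%:R + alpha * #|edges_in G S|%:R.

Lemma gnp_weight_ge0 n p (G : graph n) : 0 <= p <= 1 -> 0 <= gnp_weight p G.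
Proof.
by case/andP=> p0 p1; apply: prodr_ge0 => e _; case: ifP => _; rewrite ?subr_ge0.
Qed.

Lemma gnp_prob_le n p (P Q : graph n -> Prop) : 0 <= p <= 1 ->
  (forall G, P G -> Q G) -> gnp_prob p P <= gnp_prob p Q.
Proof.
move=> p01 PQ; rewrite /gnp_prob [leLHS]big_mkcond [leRHS]big_mkcond.
apply: ler_sum => G _; case: asboolP => [/PQ QG|_]; first by rewrite asboolT.
by case: ifP => // _; apply: gnp_weight_ge0.
Qed.

Lemma gnp_prob_le1 n p (P : graph n -> Prop) : 0 <= p <= 1 -> gnp_prob p P <= 1.
Proof.
move=> p01; rewrite -(gnp_weight_sum n p) /gnp_prob [leLHS]big_mkcond.
by apply: ler_sum => G _; case: ifP => // _; apply: gnp_weight_ge0.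
Qed.

Lemma gnp_prob_not n p (P : graph n -> Prop) :
  gnp_prob p P = 1 - gnp_prob p (fun G => ~ P G).
Proof.
apply/eqP; rewrite eq_sym subr_eq -(gnp_weight_sum n p).
rewrite (bigID (fun G => `[< P G >])) /=; apply/eqP; congr (_ + _).
by apply: eq_bigl => G; rewrite asbool_neg.
Qed.

Lemma gnp_prob_superset n p (F : graph n) :
  \sum_(G : graph n | F \subset G) gnp_weight p G = p ^+ #|F|.
Proof.
(* When the product is expanded, the summand 0 kills every graph that misses an edge of [F]. *)
transitivity (\prod_(e : vpair n) (p + (if e \in F then 0 else 1 - p))).
  rewrite bigA_distr [LHS]big_mkcond.
  apply: eq_big => [G|G _]; first by rewrite inE.
  case: ifP => [/subsetP FG|/negbT /subsetPn[e eF eG]].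
    by apply: eq_bigr => e _; case: ifP => // /negbT eG; rewrite ifN //; apply: contra eG => /FG.
  by rewrite (bigD1 e) //= (negPf eG) eF mul0r.
rewrite -prodr_const [RHS]big_mkcond; apply: eq_bigr => e _.
by case: ifP; rewrite ?addr0 // addrC subrK.
Qed.

Lemma sum_expr_card n (y : R) : \sum_(S : {set 'I_n}) y ^+ #|S| = (1 + y) ^+ n.
Proof.
transitivity (\prod_(i < n) (y + 1)); last by rewrite prodr_const card_ord addrC.
rewrite bigA_distr; apply: eq_big => [S|S _]; first by rewrite inE.
by rewrite -prodr_const [LHS]big_mkcond.
Qed.

(** This gives one rate of decay for the finitely many negative exponents; the 1 in the minimum
    covers the case of no negative value. *)
Lemma negative_gap (T : finType) (g : T -> R) :
  exists2 d, 0 < d & forall x, g x < 0 -> g x <= - d.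
Proof.
exists (\big[Num.min/1]_(x | g x < 0) - g x).
  by apply: lt_bigmin => // x; rewrite oppr_gt0.
by move=> x gx; rewrite lerNr; apply: bigmin_le_cond.
Qed.

Definition pairs_in n (S : {set 'I_n}) : {set vpair n} := [set e : vpair n | val e \subset S].

Lemma card_pairs_in n (S : {set 'I_n}) : (#|pairs_in S| <= 2 ^ #|S|)%N.
Proof.
rewrite -card_powerset -(card_imset _ val_inj).
by apply/subset_leq_card/subsetP => _ /imsetP[e + ->]; rewrite !inE.
Qed.

(* First moment: union bound over the pairs x of a vertex set x.1 and an edge
   set x.2 within it that is too large. *)
Lemma gnp_prob_not_sparse n p alpha M : 0 <= p <= 1 ->
  gnp_prob p (fun G : graph n => ~ sparse_graph alpha M G) <=
  \sum_(x : {set 'I_n} * {set vpair n} | [&& (#|x.1| <= M)%N,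
      x.2 \subset pairs_in x.1 & #|x.1|%:R + alpha * #|x.2|%:R < 0]) p ^+ #|x.2|.
Proof.
move=> p01; under [leRHS]eq_bigr do rewrite -gnp_prob_superset.
rewrite (exchange_big_dep xpredT) //= /gnp_prob [leLHS]big_mkcond.
apply: ler_sum => G _; have w0 := gnp_weight_ge0 G p01.
case: asboolP => [|_]; last exact: sumr_ge0.
move=> nsp; have [S [SM neg]] : exists S : {set 'I_n}, (#|S| <= M)%N /\
    #|S|%:R + alpha * #|edges_in G S|%:R < 0.
  apply: contrapT => H; apply: nsp => S SM; rewrite leNgt; apply/negP => neg.
  by apply: H; exists S.
rewrite (bigD1 (S, edges_in G S)) /= ?lerDl ?sumr_ge0 //.
rewrite SM neg andbT; apply/andP; split; apply/subsetP => e; rewrite !inE => /andP[] //.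
Qed.

Lemma powR_nat_le1 n alpha : (0 < n)%N -> alpha <= 0 -> 0 <= n%:R `^ alpha <= 1.
Proof.
move=> n0 alpha0; rewrite powR_ge0.
by have := @ler_powR R n%:R; rewrite ler1n n0 => /(_ isT _ _ alpha0); rewrite powRr0.
Qed.

(** A negative exponent is at most [- d], so each term is at most [n^(- d) * n^(- #|S|)]. At most
    [2 ^ 2 ^ M] edge sets belong to one [S], and summing [n^(- #|S|)] over all [S] gives
    [(1 + 1/n)^n], at most e. *)
Lemma gnp_prob_not_sparse_le alpha M : exists C d : R, 0 < d /\
  forall n, (0 < n)%N -> alpha <= 0 ->
    gnp_prob (n%:R `^ alpha) (fun G : graph n => ~ sparse_graph alpha M G) <=
    C * n%:R `^ (- d).
Proof.
(* The gap is taken over pairs of cardinalities rather than pairs of sets, so that [d] does not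
   depend on [n]. *)
have [d d0 dP] := negative_gap
  (fun x : 'I_M.+1 * 'I_(2 ^ M).+1 => x.1%:R + alpha * x.2%:R).
exists (expR 1 * (2 ^ 2 ^ M)%:R), d; split=> // n n0 alpha0.
have n1 : 1 <= n%:R :> R by rewrite ler1n.
apply: le_trans (gnp_prob_not_sparse n alpha M (powR_nat_le1 n0 alpha0)) _.
have pE M' (S : {set 'I_n}) : (#|S| <= M')%N -> (#|pairs_in S| <= 2 ^ M')%N.
  by move=> SM; apply: leq_trans (card_pairs_in S) _; rewrite leq_exp2l.
apply: (@le_trans _ _ (\sum_(x : {set 'I_n} * {set vpair n} |
    (#|x.1| <= M)%N && (x.2 \subset pairs_in x.1)) n%:R `^ (- d) * n%:R^-1 ^+ #|x.1|)).
  rewrite [leLHS]big_mkcond [leRHS]big_mkcond; apply: ler_sum => -[S F] _ /=.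
  have rhs0 : 0 <= n%:R `^ (- d) * n%:R^-1 ^+ #|S| :> R.
    by rewrite mulr_ge0 ?powR_ge0 // exprn_ge0 // invr_ge0.
  case: ifP => [/and3P[SM FS neg]|_]; last by case: ifP.
  rewrite SM FS /=.
  have FM : (#|F| <= 2 ^ M)%N by apply: leq_trans (subset_leq_card FS) (pE _ _ SM).
  have /= := dP (inord #|S|, inord #|F|); rewrite !inordK // => /(_ neg) le.
  rewrite -powR_mulrn ?powR_ge0 // -powRrM exprVn -powR_invn ?ler0n // -powRD.
    by apply: ler_powR => //; lra.
  by rewrite pnatr_eq0 -lt0n n0 implybT.
rewrite -(pair_big_dep (fun S : {set 'I_n} => #|S| <= M)%N
  (fun (S : {set 'I_n}) (F : {set vpair n}) => F \subset pairs_in S)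
  (fun S _ => n%:R `^ (- d) * n%:R^-1 ^+ #|S|)) /=.
apply: (@le_trans _ _ (\sum_(S : {set 'I_n}) (2 ^ 2 ^ M)%:R * (n%:R `^ (- d) * n%:R^-1 ^+ #|S|))).
  rewrite [leLHS]big_mkcond; apply: ler_sum => S _.
  have rhs0 : 0 <= n%:R `^ (- d) * n%:R^-1 ^+ #|S| :> R.
    by rewrite mulr_ge0 ?powR_ge0 // exprn_ge0 // invr_ge0.
  case: ifP => [SM|_]; last by rewrite mulr_ge0 ?ler0n.
  rewrite (eq_bigl (mem (powerset (pairs_in S)))) => [|F]; last by rewrite /= inE.
  rewrite sumr_const card_powerset -[leLHS]mulr_natl ler_wpM2r // ler_nat leq_exp2l //.
  exact: pE.
have e1 : (1 + n%:R^-1) ^+ n <= expR 1 :> R.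
  rewrite -[X in expR X](divff (x := n%:R)) ?pnatr_eq0 -?lt0n // expRM_natl.
  by rewrite lerXn2r ?nnegrE ?expR_ge0 ?expR_ge1Dx // addr_ge0 ?invr_ge0.
rewrite -mulr_sumr -mulr_sumr sum_expr_card mulrA mulrC mulrA.
by rewrite ler_wpM2r ?powR_ge0 // ler_wpM2r.
Qed.

Lemma cvg_powRN_idn (d : R) : 0 < d ->
  ((n%:R : R) `^ (- d) @[n --> \oo] --> (0 : R))%classic.
Proof.
move=> d0; rewrite (_ : (fun n => _) = (fun n => ((n%:R : R) `^ d)^-1)); last first.
  by apply/funext => n; rewrite powRN.
apply/gtr0_cvgV0; first by exists 1%N => // n /= n0; rewrite powR_gt0 // ltr0n.
apply/cvgryPge => A; near=> n; apply: le_trans (ler_norm A) _.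
have -> : `|A| = (`|A| `^ d^-1) `^ d by rewrite -powRrM mulVf ?powRr1 // lt0r_neq0.
rewrite ge0_ler_powR ?(ltW d0) ?nnegrE ?powR_ge0 //.
by near: n; apply: nbhs_infty_ger.
Unshelve. all: by end_near. Qed.

Lemma aasW (p : nat -> R) (P Q : forall n, graph n -> Prop) :
  (forall n, (0 < n)%N -> 0 <= p n <= 1) ->
  (forall n (G : graph n), P n G -> Q n G) -> aas p P -> aas p Q.
Proof.
move=> p01 PQ aP; apply: (squeeze_cvgr _ aP (@cvg_cst _ (1 : R) _ _ _)).
exists 1%N => // n /= n0; rewrite gnp_prob_le1 ?p01 // andbT.
by apply: gnp_prob_le (p01 _ n0) (PQ n).
Qed.

Lemma aas_sparse alpha M : alpha <= 0 ->
  aas (fun n => n%:R `^ alpha) (@sparse_graph alpha M).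
Proof.
move=> alpha0; have [C [d [d0 bound]]] := gnp_prob_not_sparse_le alpha M.
have lim : (1 - C * (n%:R : R) `^ (- d) @[n --> \oo] --> (1 : R))%classic.
  rewrite -[X in (_ --> X)%classic]subr0 -[X in 1 - X](mulr0 C).
  by apply: cvgB; [exact: cvg_cst|apply: cvgMr; apply: cvg_powRN_idn].
apply: (squeeze_cvgr _ lim (@cvg_cst _ (1 : R) _ _ _)).
exists 1%N => // n /= n0; rewrite gnp_prob_le1 ?powR_nat_le1 // andbT.
by rewrite gnp_prob_not lerB ?bound.
Qed.

End Sparse.

(** Nonnegativity of the exponent turns into [c * e <= d * #|S|] for the number [e] of edges in [S],
    and the degree sum is at most [2 * e]. *)
Lemma sparse_sum_deg (R : realType) (alpha : R) (c d M n : nat) (G : graph n)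
    (S : {set 'I_n}) :
  sparse_graph alpha M G -> (0 < d)%N -> alpha <= - (c%:R / d%:R) ->
  (#|S| <= M)%N -> (c * \sum_(u in S) deg G S u <= 2 * d * #|S|)%N.
Proof.
move=> sp d0 ac /sp S0.
apply: leq_trans (leq_mul (leqnn c) (sum_deg G S)) _.
rewrite mulnCA -mulnA leq_mul2l -(ler_nat R) !natrM.
have := ler_wpM2r (ler0n R #|edges_in G S|) ac; rewrite mulNr => aE.
have : c%:R / d%:R * #|edges_in G S|%:R <= #|S|%:R :> R by lra.
by rewrite mulrAC ler_pdivrMr ?ltr0n // [leRHS]mulrC.
Qed.

Theorem proposition4 (R : realType) (l m : nat) (alpha : R)
    (l_gt0 : (0 < l)%N) (m_gt0 : (0 < m)%N)
    (alpha_even : ~~ odd l -> alpha \in `[-2, - 4 / (l%:R + 2)])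
    (alpha_odd : odd l ->
      alpha \in `[-2, - 4 * (l%:R + 2) / ((l%:R + 1) * (l%:R + 3))]) :
  aas (fun n => n%:R `^ alpha)
      (fun n (G : graph n) =>
         trivial_group (reduced_homology (multineighbor_complex m G) l)).
Proof.
pose a := l./2.+1.
have [c [d [d0 ac sparse_acyclic]]] : exists c d, [/\ (0 < d)%N,
    alpha <= - (c%:R / d%:R) & forall n (G : graph n),
    (forall S : {set 'I_n}, (#|S| <= 4 * a)%N ->
      (c * \sum_(u in S) deg G S u <= 2 * d * #|S|)%N) ->
    acyclic (closed_sets m G) l.+1].
  have lE := odd_double_half l; case: (boolP (odd l)) => lodd.
    have {}lE : l.+1 = (2 * a)%N by rewrite /a; move: lE; rewrite lodd; lia.
    (* [c / d] is the ratio of vertices to edges in K_(a,a+1), and [- c / d] is the right endpoint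
       of the interval. *)
    exists (2 * a).+1, (a * a.+1)%N; split=> [||n G sp].
    - by rewrite muln_gt0.
    - have := alpha_odd lodd; rewrite in_itv /= => /andP[_].
      have -> : l%:R = 2 * a%:R - 1 :> R by rewrite -natrM -lE -natr1 addrK.
      move=> /le_trans; apply; rewrite le_eqVlt; apply/orP; left; apply/eqP.
      have -> : (2 * a).+1%:R = 2 * a%:R + 1 :> R by rewrite -natr1 natrM.
      have -> : (a * a.+1)%:R = a%:R * (a%:R + 1) :> R by rewrite natrM -natr1.
      have apos : 0 < a%:R :> R by rewrite ltr0n.
      by field; rewrite !lt0r_neq0 //; lra.
    - rewrite lE; apply: acyclic_no_chain (closed_sets0 _ _) (@cap_closed_sets _ _ _) _.
      by move=> ch; apply: sparse_no_chain => // S S4; have := sp S S4; rewrite mulnA.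
  have {}lE : l = (2 * a.-1)%N by rewrite /a; move: lE; rewrite (negPf lodd); lia.
  have a1 : (1 < a)%N by rewrite /a; lia.
  (* Here [2 / a] is the ratio of vertices to edges in K_(a,a), again matching the right
     endpoint. *)
  exists 2%N, a; split=> [||n G sp] //.
  - have := alpha_even lodd; rewrite in_itv /= => /andP[_].
    have -> : l%:R = 2 * a%:R - 2 :> R.
      by rewrite lE natrM -subn1 natrB // mulrBr mulr1.
    move=> /le_trans; apply; rewrite le_eqVlt; apply/orP; left; apply/eqP.
    have apos : 0 < a%:R :> R by rewrite ltr0n.
    by field; rewrite !lt0r_neq0 //; lra.
  (* The fork is at the middle of chains of [2 * a - 1] members, with [a - 1] members on each
     side. *)
  - have -> : l.+1 = (a.-1 + a.-2.+2)%N by rewrite lE; lia.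
    apply: acyclic_no_fork (closed_sets0 _ _) (@cap_closed_sets _ _ _) _.
    move=> p q A B pa qa; apply: sparse_no_fork m_gt0 _ _ a1 => //.
      by move=> S S4; have := sp S S4; rewrite -mulnA leq_pmul2l.
    by rewrite qa; lia.
have alpha0 : alpha <= 0.
  by apply: le_trans ac _; rewrite oppr_le0 divr_ge0.
apply: aasW (aas_sparse (4 * a) alpha0) => [n n0|n G sp].
  exact: powR_nat_le1.
by apply/multineighbor_homology_acyclic/sparse_acyclic => S; apply: sparse_sum_deg sp d0 ac.
Qed.
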